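(* Let $\Gamma\curvearrowright X, I$ be a dynamical ideal with permutation model $W[[X]]$. (1) If $W[[X]]$ fails the axiom of dependent choices, then Player I has a winning strategy in the DC game. (2) If $X$ is a Polish space and $I$ is generated (as an ideal, i.e. $I$ consists of all subsets of sets in the family) by an analytic family of closed subsets of $X$ (analytic in the Effros Borel space / hyperspace of closed sets), then the DC game is determined.
   Context: Work in ZFC. $V[[X]]$ is the well-founded model of ZFCA with set of atoms exactly $X$ in which every set of elements is represented by an element; a group action of $\Gamma$ on $X$ extends to $V[[X]]$ by $\gamma\cdot A=\{\gamma\cdot B:B\in A\}$. $\mathrm{stab}(A)=\{\gamma:\gamma\cdot A=A\}$, $\mathrm{pstab}(a)=\{\gamma:\gamma\cdot B=B\ \forall B\in a\}$. A dynamical ideal $\Gamma\curvearrowright X, I$: a group $\Gamma$ acting on $X$ and a $\Gamma$-invariant ideal $I$ on $X$ containing all singletons. Its permutation model $W[[X]]$ is the class of $A\in V[[X]]$ such that $A$ and every element of its transitive closure are symmetric, where $A$ is symmetric if $\mathrm{pstab}(b)\subseteq\mathrm{stab}(A)$ for some $b\in I$. The axiom of dependent choices (DC): every partial order has either a minimal element or an infinite strictly descending sequence. The DC game: players I and II alternate for $\omega$ rounds; at round $n$ Player I plays $a_n\in I$ and Player II answers with $\gamma_n\in\Gamma$, subject to the rules $\gamma_0=1$ and $\gamma_n$ fixes every element of $\bigcup_{m<n}\gamma_m\cdot a_m$. Player II wins if $\bigcup_{n\in\omega}\gamma_n\cdot a_n\in I$; otherwise Player I wins. The game is determined if one of the players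 has a winning strategy. *)

(* Defs.v *)
From Stdlib Require Import Reals List.
Open Scope R_scope.

Record DynIdeal (X : Type) := {
  Gam : Type;
  gmul : Gam -> Gam -> Gam;
  gone : Gam;
  ginv : Gam -> Gam;
  gmulA : forall a b c, gmul a (gmul b c) = gmul (gmul a b) c;
  gmul1l : forall a, gmul gone a = a;
  gmulVl : forall a, gmul (ginv a) a = gone;
  gact : Gam -> X -> X;
  gact1 : forall x, gact gone x = x;
  gactM : forall g h x, gact (gmul g h) x = gact g (gact h x);
  ideal : (X -> Prop) -> Prop;
  ideal_sub : forall a b, ideal b -> (forall x, a x -> b x) -> ideal a;
  ideal_union : forall a b, ideal a -> ideal b -> ideal (fun x => a x \/ b x);
  ideal_single : forall x, ideal (fun y => y = x);
  ideal_inv : forall g a, ideal a -> ideal (fun y => exists x, a x /\ y = gact g x)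
}.

Arguments Gam {X}.
Arguments gmul {X}.
Arguments gone {X}.
Arguments ginv {X}.
Arguments gact {X}.
Arguments ideal {X}.

Definition gimage {X} (D : DynIdeal X) (g : Gam D) (a : X -> Prop) : X -> Prop :=
  fun y => exists x, a x /\ y = gact D g x.

(* V[[X]] : well-founded sets with atoms X (Aczel-style trees, with    *)
(* extensional equality veq).  Every family indexed by a type of the   *)
(* index universe is a set; the set of all atoms exists (vatoms).      *)

Inductive pV (X : Type) : Type :=
| Atom : X -> pV X
| VSet : forall Ix : Type, (Ix -> pV X) -> pV X.

Arguments Atom {X}.
Arguments VSet {X}.

(* the set of all atoms (also forces X to live in the index universe) *)
Definition vatoms (X : Type) : pV X := VSet X Atom.

Fixpoint veq {X} (a b : pV X) {struct a} : Prop :=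
  match a, b with
  | Atom x, Atom y => x = y
  | VSet Ix f, VSet J g =>
      (forall i, exists j, veq (f i) (g j)) /\ (forall j, exists i, veq (f i) (g j))
  | _, _ => False
  end.

Definition vmem {X} (a b : pV X) : Prop :=
  match b with
  | Atom _ => False
  | VSet J g => exists j, veq a (g j)
  end.

Fixpoint vact {X} (D : DynIdeal X) (g : Gam D) (a : pV X) : pV X :=
  match a with
  | Atom x => Atom (gact D g x)
  | VSet Ix f => VSet Ix (fun i => vact D g (f i))
  end.

Definition symmetric {X} (D : DynIdeal X) (A : pV X) : Prop :=
  exists b, ideal D b /\
    forall g : Gam D, (forall x, b x -> gact D g x = x) -> veq (vact D g A) A.

Fixpoint inW {X} (D : DynIdeal X) (A : pV X) : Prop :=
  symmetric D A /\
  match A with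
  | Atom _ => True
  | VSet Ix f => forall i, inW D (f i)
  end.

Definition vupair {X} (a b : pV X) : pV X := VSet bool (fun t => if t then a else b).
Definition vkpair {X} (a b : pV X) : pV X := vupair (vupair a a) (vupair a b).

Definition vsucc {X} (a : pV X) : pV X :=
  match a with
  | Atom _ => a
  | VSet Ix f => VSet (option Ix) (fun o => match o with None => VSet Ix f | Some i => f i end)
  end.

Fixpoint vnat {X} (n : nat) : pV X :=
  match n with
  | O => VSet Empty_set (Empty_set_rect _)
  | S n => vsucc (vnat n)
  end.

Definition vle {X} (R a b : pV X) : Prop := vmem (vkpair a b) R.

Definition is_partial_order {X} (P R : pV X) : Prop :=
  (forall r, vmem r R -> exists a b, vmem a P /\ vmem b P /\ veq r (vkpair a b)) /\
  (forall a, vmem a P -> vle R a a) /\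
  (forall a b, vmem a P -> vmem b P -> vle R a b -> vle R b a -> veq a b) /\
  (forall a b c, vmem a P -> vmem b P -> vmem c P -> vle R a b -> vle R b c -> vle R a c).

Definition vlt {X} (R a b : pV X) : Prop := vle R a b /\ ~ veq a b.

Definition DC_in_W {X} (D : DynIdeal X) : Prop :=
  forall P R : pV X, inW D P -> inW D R -> is_partial_order P R ->
    (exists p, vmem p P) ->
    (exists m, vmem m P /\ forall q, vmem q P -> ~ vlt R q m) \/
    (exists s : nat -> pV X,
        (forall n, vmem (s n) P) /\
        (forall n, vlt R (s (S n)) (s n)) /\
        inW D (VSet nat (fun n => vkpair (vnat n) (s n)))).

Definition prefix {A} (u : nat -> A) (n : nat) : list A := map u (seq 0 n).

Definition legal_play {X} (D : DynIdeal X) (a : nat -> X -> Prop) (gam : nat -> Gam D) : Prop :=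
  gam 0%nat = gone D /\
  forall n m, (m < n)%nat -> forall y, gimage D (gam m) (a m) y -> gact D (gam n) y = y.

Definition play_union {X} (D : DynIdeal X) (a : nat -> X -> Prop) (gam : nat -> Gam D) : X -> Prop :=
  fun y => exists n, gimage D (gam n) (a n) y.

Definition PlayerI_wins {X} (D : DynIdeal X) : Prop :=
  exists sI : list (Gam D) -> (X -> Prop),
    (forall h, ideal D (sI h)) /\
    forall gam : nat -> Gam D,
      legal_play D (fun n => sI (prefix gam n)) gam ->
      ~ ideal D (play_union D (fun n => sI (prefix gam n)) gam).

Definition PlayerII_wins {X} (D : DynIdeal X) : Prop :=
  exists sII : list (X -> Prop) -> Gam D,
    forall a : nat -> X -> Prop, (forall n, ideal D (a n)) ->
      legal_play D a (fun n => sII (prefix a (S n))) /\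
      ideal D (play_union D a (fun n => sII (prefix a (S n)))).

Definition DC_game_determined {X} (D : DynIdeal X) : Prop :=
  PlayerI_wins D \/ PlayerII_wins D.

Definition is_metric {X} (d : X -> X -> R) : Prop :=
  (forall x y, 0 <= d x y) /\ (forall x y, d x y = 0 <-> x = y) /\
  (forall x y, d x y = d y x) /\ (forall x y z, d x z <= d x y + d y z).

Definition m_open {X} (d : X -> X -> R) (U : X -> Prop) : Prop :=
  forall x, U x -> exists eps, 0 < eps /\ forall y, d x y < eps -> U y.

Definition m_closed {X} (d : X -> X -> R) (F : X -> Prop) : Prop :=
  m_open d (fun x => ~ F x).

Definition m_complete {X} (d : X -> X -> R) : Prop :=
  forall u : nat -> X,
    (forall eps, 0 < eps -> exists N, forall m n, (N <= m)%nat -> (N <= n)%nat -> d (u m) (u n) < eps) ->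
    exists l, forall eps, 0 < eps -> exists N, forall n, (N <= n)%nat -> d (u n) l < eps.

Definition m_separable {X} (d : X -> X -> R) : Prop :=
  exists e : nat -> option X,
    forall x eps, 0 < eps -> exists n y, e n = Some y /\ d x y < eps.

Definition polish_metric {X} (d : X -> X -> R) : Prop :=
  is_metric d /\ m_complete d /\ m_separable d.

Inductive sgen {T : Type} (Gn : (T -> Prop) -> Prop) : (T -> Prop) -> Prop :=
| sg_base E : Gn E -> sgen Gn E
| sg_ext E E' : sgen Gn E -> (forall t, E t <-> E' t) -> sgen Gn E'
| sg_compl E : sgen Gn E -> sgen Gn (fun t => ~ E t)
| sg_union (E : nat -> T -> Prop) : (forall n, sgen Gn (E n)) -> sgen Gn (fun t => exists n, E n t).

Definition baire_open (U : (nat -> nat) -> Prop) : Prop :=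
  forall s, U s -> exists n, forall t, (forall i, (i < n)%nat -> t i = s i) -> U t.

Definition ClosedSet {X} (d : X -> X -> R) := { F : X -> Prop | m_closed d F }.

Definition effros_gen {X} (d : X -> X -> R) (E : ClosedSet d -> Prop) : Prop :=
  exists U, m_open d U /\ forall F : ClosedSet d, E F <-> exists x, proj1_sig F x /\ U x.

Definition borel_to_effros {X} (d : X -> X -> R) (f : (nat -> nat) -> ClosedSet d) : Prop :=
  forall E, sgen (effros_gen d) E -> sgen baire_open (fun s => E (f s)).

Definition effros_analytic {X} (d : X -> X -> R) (A : ClosedSet d -> Prop) : Prop :=
  (forall F, ~ A F) \/
  exists f : (nat -> nat) -> ClosedSet d,
    borel_to_effros d f /\ forall F, A F <-> exists s, f s = F.

Definition ideal_generated_by {X} (D : DynIdeal X) (d : X -> X -> R) (A : ClosedSet d -> Prop) : Prop :=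
  forall a, ideal D a <-> exists F, A F /\ forall x, a x -> proj1_sig F x.

(* Main.v *)
Require Import Defs.
From Stdlib Require Import Reals List.
From Stdlib Require Import Lra Lia Classical ClassicalEpsilon FunctionalExtensionality Cantor.
Import ListNotations.

(** (1) Given a partial order in W without minimal elements and without
    descending sequences in W, Player I keeps playing a support of an element
    [p] strictly below the image [gamma_n . p_n] of his previous element.  The
    later answers fix the earlier supports, so the elements [gamma_n . p_n]
    descend, and the union of the sets [gamma_n . a_n] would support the whole
    sequence.

    (2) The family generating the ideal can be written as [{x | R z x}], [z] in
    the Baire space, so that [{z | R z x}] is closed for each [x].  Let Player
    II also play the entries of such a [z]; the game becomes closed for him,
    hence determined.  If Player I wins the auxiliary game, he wins the DC game
    by running, for all finite initial segments of possible [z] at once, the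
    corresponding auxiliary plays, one segment in each round: an answer that is
    legal in the DC game is legal in every auxiliary play. *)

(** * Sets with atoms *)

Lemma veq_refl {X} (a : pV X) : veq a a.
Proof.
  induction a as [x|I f IH]; simpl; [easy|].
  split; intro i; exists i; apply IH.
Qed.

Lemma veq_sym {X} (a b : pV X) : veq a b -> veq b a.
Proof.
  revert b; induction a as [x|I f IH]; intros [y|J g]; simpl; try easy.
  intros [H1 H2]; split.
  - intro j; destruct (H2 j) as [i Hi]; exists i; auto.
  - intro i; destruct (H1 i) as [j Hj]; exists j; auto.
Qed.

Lemma veq_trans {X} (a b c : pV X) : veq a b -> veq b c -> veq a c.
Proof.
  revert b c; induction a as [x|I f IH]; intros [y|J g] [z|K h]; simpl; try easy.
  - congruence.
  - intros [H1 H2] [H3 H4]; split.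
    + intro i; destruct (H1 i) as [j Hj]; destruct (H3 j) as [k Hk]; exists k; eauto.
    + intro k; destruct (H4 k) as [j Hj]; destruct (H2 j) as [i Hi]; exists i; eauto.
Qed.

Lemma veq_pointwise {X} (I : Type) (f g : I -> pV X) :
  (forall i, veq (f i) (g i)) -> veq (VSet I f) (VSet I g).
Proof. intro H; split; intro i; exists i; apply H. Qed.

Lemma vmem_veq_l {X} (a b c : pV X) : veq a b -> vmem a c -> vmem b c.
Proof.
  destruct c as [x|J g]; simpl; [easy|].
  intros H [j Hj]; exists j; eauto using veq_trans, veq_sym.
Qed.

Lemma vmem_veq_r {X} (a b c : pV X) : veq b c -> vmem a b -> vmem a c.
Proof.
  destruct b as [x|I f], c as [y|J g]; simpl; try easy.
  intros [H _] [i Hi]; destruct (H i) as [j Hj]; exists j; eauto using veq_trans.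
Qed.

Lemma vupair_veq {X} (a a' b b' : pV X) :
  veq a a' -> veq b b' -> veq (vupair a b) (vupair a' b').
Proof. intros; apply veq_pointwise; intros [|]; assumption. Qed.

Lemma vkpair_veq {X} (a a' b b' : pV X) :
  veq a a' -> veq b b' -> veq (vkpair a b) (vkpair a' b').
Proof. intros; apply vupair_veq; apply vupair_veq; assumption. Qed.

Lemma vle_veq {X} (R a a' b b' : pV X) :
  veq a a' -> veq b b' -> vle R a b -> vle R a' b'.
Proof. intros Ha Hb; apply vmem_veq_l, vkpair_veq; assumption. Qed.

(** * The group action on sets, supports, and closure properties of the permutation model *)

Section Action.
Context {X : Type} (D : DynIdeal X).
Implicit Types (g h : Gam D) (A B : pV X) (b : X -> Prop).

Definition fixes g b := forall x, b x -> gact D g x = x.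

Definition supports b A := forall g, fixes g b -> veq (vact D g A) A.

Lemma vact_veq g A B : veq A B -> veq (vact D g A) (vact D g B).
Proof.
  revert B; induction A as [x|I f IH]; intros [y|J k]; simpl; try easy.
  - congruence.
  - intros [H1 H2]; split.
    + intro i; destruct (H1 i) as [j Hj]; exists j; auto.
    + intro j; destruct (H2 j) as [i Hi]; exists i; auto.
Qed.

Lemma vact_one A : veq (vact D (gone D) A) A.
Proof.
  induction A as [x|I f IH]; simpl; [apply gact1|].
  apply veq_pointwise, IH.
Qed.

Lemma vact_mul g h A : veq (vact D (gmul D g h) A) (vact D g (vact D h A)).
Proof.
  induction A as [x|I f IH]; simpl; [apply gactM|].
  apply veq_pointwise, IH.
Qed.

Lemma vactK g A : veq (vact D (ginv D g) (vact D g A)) A.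
Proof.
  eapply veq_trans; [apply veq_sym, vact_mul|].
  rewrite gmulVl; apply vact_one.
Qed.

Lemma vact_inj g A B : veq (vact D g A) (vact D g B) -> veq A B.
Proof.
  intro H; apply (vact_veq (ginv D g)) in H.
  eapply veq_trans; [apply veq_sym, vactK|].
  eapply veq_trans; [apply H|apply vactK].
Qed.

Lemma vact_mem g A B : vmem A B -> vmem (vact D g A) (vact D g B).
Proof.
  destruct B as [x|J k]; simpl; [easy|].
  intros [j Hj]; exists j; apply vact_veq, Hj.
Qed.

Lemma vact_upair g A B : veq (vact D g (vupair A B)) (vupair (vact D g A) (vact D g B)).
Proof. apply veq_pointwise; intros [|]; apply veq_refl. Qed.

Lemma vact_kpair g A B : veq (vact D g (vkpair A B)) (vkpair (vact D g A) (vact D g B)).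
Proof.
  eapply veq_trans; [apply vact_upair|].
  apply vupair_veq; apply vact_upair.
Qed.

Lemma vact_le g R A B :
  veq (vact D g R) R -> vle R A B -> vle R (vact D g A) (vact D g B).
Proof.
  intros HR H; apply (vact_mem g) in H.
  apply (vmem_veq_r _ _ _ HR) in H.
  apply (vmem_veq_l _ _ _ (vact_kpair g A B) H).
Qed.

Lemma vact_lt g R A B :
  veq (vact D g R) R -> vlt R A B -> vlt R (vact D g A) (vact D g B).
Proof.
  intros HR [H1 H2]; split; [apply vact_le; assumption|].
  intro H; apply H2, (vact_inj g), H.
Qed.

Lemma vlt_veq_r R A B B' : veq B B' -> vlt R A B -> vlt R A B'.
Proof.
  intros HB [H1 H2]; split; [eapply vle_veq; eauto using veq_refl|].
  intro H; apply H2; eauto using veq_trans, veq_sym.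
Qed.

Lemma supports_upair b A B : supports b A -> supports b B -> supports b (vupair A B).
Proof.
  intros HA HB g Hg; eapply veq_trans; [apply vact_upair|].
  apply vupair_veq; auto.
Qed.

(** Conjugation: if [h] fixes the image of [b] under [g] pointwise, then the inverse of [g] times
    [h] times [g] fixes [b] pointwise. *)
Lemma supports_gimage b g A : supports b A -> supports (gimage D g b) (vact D g A).
Proof.
  intros H h Hh; apply (vact_inj (ginv D g)).
  eapply veq_trans; [|apply veq_sym, vactK].
  eapply veq_trans; [apply veq_sym, vact_veq, vact_mul|].
  eapply veq_trans; [apply veq_sym, vact_mul|].
  apply H; intros x Hx.
  rewrite !gactM, (Hh (gact D g x)) by (exists x; auto).
  rewrite <- gactM, gmulVl; apply gact1.
Qed.

Lemma inW_symmetric A : inW D A -> symmetric D A.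
Proof. destruct A; simpl; tauto. Qed.

Lemma symmetric_veq A B : veq A B -> symmetric D A -> symmetric D B.
Proof.
  intros H [b [Hb HA]]; exists b; split; [exact Hb|]; intros g Hg.
  eapply veq_trans; [apply vact_veq, veq_sym, H|].
  eapply veq_trans; [apply HA, Hg|exact H].
Qed.

Lemma inW_veq A B : veq A B -> inW D A -> inW D B.
Proof.
  revert B; induction A as [x|I f IH]; intros B H HA.
  - destruct B; [|easy]; simpl in *; subst; assumption.
  - pose proof (symmetric_veq _ _ H (inW_symmetric _ HA)) as HB.
    destruct B as [y|J k]; [easy|]; split; [exact HB|].
    intro j; destruct H as [_ H]; destruct (H j) as [i Hi].
    apply (IH i); [exact Hi|apply HA].
Qed.

Lemma inW_vmem A B : vmem A B -> inW D B -> inW D A.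
Proof.
  destruct B as [x|J k]; simpl; [easy|].
  intros [j Hj] [_ H]; apply (inW_veq (k j)); auto using veq_sym.
Qed.

Section Supported.
Context (b : X -> Prop) (Hb : ideal D b).

Lemma inW_VSet (I : Type) (f : I -> pV X) :
  (forall i, supports b (f i)) -> (forall i, inW D (f i)) -> inW D (VSet I f).
Proof.
  intros Hs Hf; split; [|exact Hf].
  exists b; split; [exact Hb|]; intros g Hg.
  apply veq_pointwise; intro i; exact (Hs i g Hg).
Qed.

Lemma inW_upair A B :
  supports b A -> supports b B -> inW D A -> inW D B -> inW D (vupair A B).
Proof. intros; apply inW_VSet; intros [|]; assumption. Qed.

Lemma inW_kpair A B :
  supports b A -> supports b B -> inW D A -> inW D B -> inW D (vkpair A B).
Proof. intros; apply inW_upair; auto using supports_upair, inW_upair. Qed.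

Lemma vact_nat g n : veq (vact D g (vnat n)) (vnat n).
Proof.
  induction n as [|n IH]; simpl.
  - apply veq_pointwise; intros [].
  - destruct (vnat n) as [x|I f]; [exact IH|].
    simpl; destruct IH as [H1 H2]; split.
    + intros [i|]; [destruct (H1 i) as [j Hj]; exists (Some j); exact Hj|].
      exists None; split; assumption.
    + intros [i|]; [destruct (H2 i) as [j Hj]; exists (Some j); exact Hj|].
      exists None; split; assumption.
Qed.

Lemma supports_nat n : supports b (vnat n).
Proof. intros g _; apply vact_nat. Qed.

Lemma inW_nat n : inW D (vnat n).
Proof.
  assert (H : symmetric D (vnat n)) by (exists b; split; [exact Hb|apply supports_nat]).
  induction n as [|n IH]; simpl in *.
  - split; [exact H|intros []].
  - specialize (IH (ex_intro _ b (conj Hb (supports_nat n)))).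
    destruct (vnat n) as [x|I f]; [exact IH|].
    split; [exact H|]; intros [i|]; [apply IH|exact IH].
Qed.

(** One common support for all terms supports the sequence as a set, since every group element fixes
    the natural numbers. *)
Lemma inW_sequence (s : nat -> pV X) :
  (forall n, supports b (s n)) -> (forall n, inW D (s n)) ->
  inW D (VSet nat (fun n => vkpair (vnat n) (s n))).
Proof.
  intros Hs Hw; apply inW_VSet; intro n.
  - apply supports_upair; apply supports_upair; auto using supports_nat.
  - apply inW_kpair; auto using supports_nat, inW_nat.
Qed.

End Supported.
End Action.

(** * Failure of dependent choices *)

Lemma prefix_S {A} (u : nat -> A) n : prefix u (S n) = prefix u n ++ [u n].
Proof. unfold prefix; rewrite seq_S, map_app; reflexivity. Qed.

Section Descent.
Context {X : Type} (D : DynIdeal X) (P R p0 : pV X) (b0 : X -> Prop).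
Context (PW : inW D P) (p0P : vmem p0 P) (b0I : ideal D b0).
Context (b0P : supports D b0 P) (b0R : supports D b0 R).
Context (nomin : forall m, vmem m P -> exists q, vmem q P /\ vlt R q m).

Definition below (q : pV X) : pV X := epsilon (inhabits q) (fun p => vmem p P /\ vlt R p q).

Lemma belowP q : vmem q P -> vmem (below q) P /\ vlt R (below q) q.
Proof. intro Hq; apply (epsilon_spec (inhabits q) (fun p => vmem p P /\ vlt R p q)), nomin, Hq. Qed.

(** The condition makes the choice total: a set in the ideal is returned even for non-symmetric [p],
    so that Player I's move lies in the ideal after every history. *)
Definition support (p : pV X) : X -> Prop :=
  epsilon (inhabits b0) (fun b => ideal D b /\ (symmetric D p -> supports D b p)).

Lemma supportP p : ideal D (support p) /\ (symmetric D p -> supports D (support p) p).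
Proof.
  apply (epsilon_spec (inhabits b0) (fun b => ideal D b /\ (symmetric D p -> supports D b p))).
  destruct (classic (symmetric D p)) as [[b [Hb Hs]]|H].
  - exists b; auto.
  - exists b0; split; [exact b0I|tauto].
Qed.

Definition candidate (h : list (Gam D)) : pV X :=
  fold_left (fun p g => below (vact D g p)) h p0.

(** The part [b0] forces all answers to preserve [P] and [R]; the other part makes later answers fix
    the image of the current candidate. *)
Definition descent_move (h : list (Gam D)) : X -> Prop :=
  fun x => b0 x \/ support (candidate h) x.

Lemma descent_move_ideal h : ideal D (descent_move h).
Proof. apply ideal_union; [exact b0I|apply supportP]. Qed.

Section Play.
Context (gam : nat -> Gam D).
Let a n := descent_move (prefix gam n).
Context (legal : legal_play D a gam).
Let p n := candidate (prefix gam n).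
Let q n := vact D (gam n) (p n).

Let p_S n : p (S n) = below (q n).
Proof. unfold p, candidate; rewrite prefix_S, fold_left_app; reflexivity. Qed.

Let gam_fixes_b0 n : fixes D (gam n) b0.
Proof.
  destruct legal as [H0 H]; intros x Hx; destruct n as [|n].
  - rewrite H0; apply gact1.
  (* Since the answer in round 0 is the identity, the set that later answers must fix after that
     round contains [b0] itself. *)
  - apply (H (S n) 0%nat); [lia|].
    exists x; split; [left; exact Hx|].
    rewrite H0; symmetry; apply gact1.
Qed.

Let gam_P n A : vmem A P -> vmem (vact D (gam n) A) P.
Proof.
  intro H; apply (vact_mem D (gam n)) in H.
  apply (vmem_veq_r _ _ _ (b0P _ (gam_fixes_b0 n)) H).
Qed.

Let p_P n : vmem (p n) P.
Proof.
  induction n as [|n IH]; [exact p0P|].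
  rewrite p_S; apply belowP, gam_P, IH.
Qed.

Let q_P n : vmem (q n) P.
Proof. apply gam_P, p_P. Qed.

Let q_supports n : supports D (gimage D (gam n) (a n)) (q n).
Proof.
  apply supports_gimage; intros g Hg; apply supportP.
  - apply inW_symmetric; apply (inW_vmem D _ P); auto.
  - intros x Hx; apply Hg; right; exact Hx.
Qed.

(** The answer in round [S n] fixes a support of [q n], hence [q n] itself, and it preserves [R];
    applying it to [p (S n)] below [q n] gives the claim. *)
Let q_desc n : vlt R (q (S n)) (q n).
Proof.
  apply (vlt_veq_r R (q (S n)) (vact D (gam (S n)) (q n))).
  - apply q_supports; intros x Hx; apply (proj2 legal (S n) n); auto.
  - apply vact_lt; [apply b0R, gam_fixes_b0|].
    rewrite p_S; apply belowP, q_P.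
Qed.

Lemma descending_sequence :
  ideal D (play_union D a gam) ->
  exists s : nat -> pV X,
    (forall n, vmem (s n) P) /\ (forall n, vlt R (s (S n)) (s n)) /\
    inW D (VSet nat (fun n => vkpair (vnat n) (s n))).
Proof.
  (* The union of the play contains a support of each [q n], so it is a common support of the whole
     sequence. *)
  intro HU; exists q; split; [exact q_P|split; [exact q_desc|]].
  apply (inW_sequence D _ HU); intro n.
  - intros g Hg; apply q_supports; intros x Hx; apply Hg; exists n; exact Hx.
  - apply (inW_vmem D _ P); auto.
Qed.

End Play.
End Descent.

Lemma not_DC_PlayerI_wins {X} (D : DynIdeal X) : ~ DC_in_W D -> PlayerI_wins D.
Proof.
  intro HDC; apply NNPP; intro HI; apply HDC; intros P R HP HR _ [p0 Hp0].
  apply NNPP; intro H; apply not_or_and in H; destruct H as [Hmin Hseq].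
  destruct (inW_symmetric D P HP) as [bP [bPI bPs]].
  destruct (inW_symmetric D R HR) as [bR [bRI bRs]].
  set (b0 := fun x => bP x \/ bR x).
  assert (b0I : ideal D b0) by (apply ideal_union; assumption).
  assert (b0P : supports D b0 P) by (intros g Hg; apply bPs; intros x Hx; apply Hg; left; exact Hx).
  assert (b0R : supports D b0 R) by (intros g Hg; apply bRs; intros x Hx; apply Hg; right; exact Hx).
  assert (nomin : forall m, vmem m P -> exists q, vmem q P /\ vlt R q m).
  { intros m Hm; apply NNPP; intro Hno; apply Hmin; exists m; split; [exact Hm|].
    intros q Hq Hlt; apply Hno; exists q; auto. }
  apply HI; exists (descent_move D P R p0 b0); split.
  - apply descent_move_ideal; assumption.
  - intros gam Hlegal HU; apply Hseq.
    apply (descending_sequence D P R p0 b0 HP Hp0 b0I b0P b0R nomin gam Hlegal HU).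
Qed.

(** * Open determinacy *)

Lemma functional_choice {A B : Type} (Q : A -> B -> Prop) :
  (forall x, exists y, Q x y) -> exists f, forall x, Q x (f x).
Proof.
  intro H; exists (fun x => proj1_sig (constructive_indefinite_description _ (H x))).
  intro x; apply proj2_sig.
Qed.

(** * Initial segments of sequences *)

Lemma prefix_cons {A} (u : nat -> A) n :
  prefix u (S n) = u 0%nat :: prefix (fun i => u (S i)) n.
Proof. unfold prefix; simpl; rewrite <- seq_shift, map_map; reflexivity. Qed.

Lemma prefix_length {A} (u : nat -> A) n : length (prefix u n) = n.
Proof. unfold prefix; rewrite length_map, length_seq; reflexivity. Qed.

Lemma prefix_nth {A} (u : nat -> A) n i x : (i < n)%nat -> nth i (prefix u n) x = u i.
Proof.
  revert u i; induction n as [|n IH]; intros u i Hi; [lia|].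
  rewrite prefix_cons; destruct i; simpl; [reflexivity|].
  apply (IH (fun i => u (S i))); lia.
Qed.

Lemma prefix_firstn {A} (u : nat -> A) n i :
  (i <= n)%nat -> firstn i (prefix u n) = prefix u i.
Proof.
  revert u i; induction n as [|n IH]; intros u [|i] Hi; try reflexivity; [lia|].
  rewrite !prefix_cons; simpl; f_equal; apply IH; lia.
Qed.

Lemma prefix_ext {A} (u v : nat -> A) n :
  (forall i, (i < n)%nat -> u i = v i) -> prefix u n = prefix v n.
Proof. intro H; apply map_ext_in; intros i Hi; apply in_seq in Hi; apply H; lia. Qed.

Lemma prefix_inj {A} (u v : nat -> A) n :
  prefix u n = prefix v n -> forall i, (i < n)%nat -> u i = v i.
Proof.
  intros H i Hi.
  rewrite <- (prefix_nth u n i (u 0%nat) Hi), H; apply prefix_nth, Hi.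
Qed.

Section OpenDeterminacy.
Context {Mv Ans : Type} (valid : Mv -> Prop) (ok : list (Mv * Ans) -> Prop).

(** The positions from which Player I can force the play out of [ok] after finitely many rounds. The
    rules binding Player II are left to [ok]. *)
Inductive I_winning : list (Mv * Ans) -> Prop :=
| I_won p : ~ ok p -> I_winning p
| I_move p a : valid a -> (forall r, I_winning (p ++ [(a, r)])) -> I_winning p.

Lemma I_winning_strategy p :
  (exists a, valid a) -> I_winning p ->
  exists sigma : list Ans -> Mv, (forall h, valid (sigma h)) /\
    forall r : nat -> Ans, exists n,
      ~ ok (p ++ prefix (fun i => (sigma (prefix r i), r i)) n).
Proof.
  intros [a0 Ha0] H; induction H as [p H|p a Ha _ IH].
  - exists (fun _ => a0); split; [auto|].
    intro r; exists 0%nat; simpl; rewrite app_nil_r; exact H.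
  - destruct (functional_choice _ IH) as [f Hf].
    (* The first answer selects the strategy for the rest of the play. *)
    exists (fun h => match h with [] => a | x :: h => f x h end); split.
    + intros [|x h]; [exact Ha|apply Hf].
    + intro r; destruct (proj2 (Hf (r 0%nat)) (fun i => r (S i))) as [n Hn].
      exists (S n); intro Hok; apply Hn; clear Hn.
      rewrite prefix_cons in Hok.
      rewrite <- app_assoc.
      erewrite prefix_ext; [exact Hok|].
      intros i _; cbv beta; rewrite prefix_cons; reflexivity.
Qed.

(** Player II can always answer so that the position stays outside [I_winning], and every such
    position satisfies [ok]. *)
Lemma not_I_winning_strategy :
  inhabited Ans -> ~ I_winning [] ->
  exists tau : list Mv -> Ans,
    forall a : nat -> Mv, (forall n, valid (a n)) ->
      forall n, ok (prefix (fun i => (a i, tau (prefix a (S i)))) n).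
Proof.
  intros inh H0.
  set (reply := fun p a => epsilon inh (fun r => ~ I_winning (p ++ [(a, r)]))).
  assert (Hreply : forall p a, ~ I_winning p -> valid a -> ~ I_winning (p ++ [(a, reply p a)])).
  { intros p a Hp Ha; apply (epsilon_spec inh (fun r => ~ I_winning (p ++ [(a, r)]))).
    apply not_all_ex_not; intro H; apply Hp; apply (I_move p a); assumption. }
  (* The position is rebuilt from Player I's moves alone. [tau] splits off the last move; its value
     on the empty list is a default, as Player II always answers a move. *)
  set (pos := fun l => fold_left (fun p a => p ++ [(a, reply p a)]) l []).
  set (tau := fun l : list Mv => match rev l with
             | [] => epsilon inh (fun _ => True)
             | a :: l => reply (pos (rev l)) a
             end).
  assert (Htau : forall l a, tau (l ++ [a]) = reply (pos l) a).
  { intros l a; unfold tau; rewrite rev_app_distr; simpl; rewrite rev_involutive; reflexivity. }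
  assert (Hpos : forall l a, pos (l ++ [a]) = pos l ++ [(a, reply (pos l) a)]).
  { intros l a; unfold pos; rewrite fold_left_app; reflexivity. }
  exists tau; intros a Ha n.
  enough (E : ~ I_winning (pos (prefix a n)) /\
    prefix (fun i => (a i, tau (prefix a (S i)))) n = pos (prefix a n)).
  { destruct E as [E1 ->]; apply NNPP; intro H; apply E1, I_won, H. }
  induction n as [|n [IH1 IH2]]; [split; [exact H0|reflexivity]|].
  rewrite (prefix_S a n), (prefix_S _ n), IH2, (prefix_S a n), Htau, Hpos; split; [|reflexivity].
  apply Hreply; auto.
Qed.

End OpenDeterminacy.

(** * Determinacy of the DC game *)

(* Strictly increasing along initial segments: the round at which a finite
   sequence is treated comes after those of its initial segments. *)
Definition seq_index (t : list nat) : nat :=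
  fold_left (fun c m => S (to_nat (c, m))) t 0%nat.

Lemma seq_index_rcons t m : seq_index (t ++ [m]) = S (to_nat (seq_index t, m)).
Proof. unfold seq_index; rewrite fold_left_app; reflexivity. Qed.

Lemma seq_index_inj t t' : seq_index t = seq_index t' -> t = t'.
Proof.
  revert t'; induction t as [|m t IH] using rev_ind; intro t';
    induction t' as [|m' t' _] using rev_ind; rewrite ?seq_index_rcons; try easy.
  intro H; apply eq_add_S, to_nat_inj in H; injection H as H ->.
  rewrite (IH t' H); reflexivity.
Qed.

Lemma seq_index_prefix_lt z i j :
  (i < j)%nat -> (seq_index (prefix z i) < seq_index (prefix z j))%nat.
Proof.
  induction 1 as [|j _ IH]; rewrite prefix_S, seq_index_rcons.
  - pose proof (to_nat_non_decreasing (seq_index (prefix z i)) (z i)); lia.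
  - pose proof (to_nat_non_decreasing (seq_index (prefix z j)) (z j)); lia.
Qed.

(** A left inverse of [seq_index]; at numbers that index no sequence the value is arbitrary, and
    Player I's move there is merely some set in the ideal. *)
Definition seq_of_index (n : nat) : list nat :=
  epsilon (inhabits []) (fun t => seq_index t = n).

Lemma seq_indexK t : seq_of_index (seq_index t) = t.
Proof.
  apply seq_index_inj.
  apply (epsilon_spec (inhabits []) (fun t' => seq_index t' = seq_index t)).
  exists t; reflexivity.
Qed.

Definition baire_closed (C : (nat -> nat) -> Prop) := baire_open (fun z => ~ C z).

Section ClosedFibres.
Context {X : Type} (D : DynIdeal X) (R : (nat -> nat) -> X -> Prop).
Context (R_closed : forall x, baire_closed (fun z => R z x)).
Context (R_ideal : forall b, ideal D b <-> exists z, forall x, b x -> R z x).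

(** Positions of the auxiliary game not yet lost for Player II. The position determines [a] and
    [gam] in the rounds played, but only an initial segment of [z]: some extension of the entries
    played has to cover the sets so far. *)
Definition aux_ok (p : list ((X -> Prop) * (Gam D * nat))) : Prop :=
  exists a gam z,
    p = prefix (fun n => (a n, (gam n, z n))) (length p) /\
    ((0 < length p)%nat -> gam 0%nat = gone D) /\
    (forall n m, (m < n < length p)%nat ->
       forall y, gimage D (gam m) (a m) y -> gact D (gam n) y = y) /\
    (forall n, (n < length p)%nat -> forall y, gimage D (gam n) (a n) y -> R z y).

(** The sequence witnessing [aux_ok] may change with the length of the position, but it agrees with
    [z] on longer and longer segments; closedness of the fibres carries the covering over to [z]. *)
Lemma aux_ok_wins a gam z :
  (forall n, aux_ok (prefix (fun i => (a i, (gam i, z i))) n)) ->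
  legal_play D a gam /\ ideal D (play_union D a gam).
Proof.
  intro H.
  assert (H' : forall N, exists a' gam' z',
    (forall i, (i < N)%nat -> a' i = a i /\ gam' i = gam i /\ z' i = z i) /\
    ((0 < N)%nat -> gam' 0%nat = gone D) /\
    (forall n m, (m < n < N)%nat ->
       forall y, gimage D (gam' m) (a' m) y -> gact D (gam' n) y = y) /\
    (forall n, (n < N)%nat -> forall y, gimage D (gam' n) (a' n) y -> R z' y)).
  { intro N; destruct (H N) as [a' [gam' [z' [E H']]]].
    rewrite prefix_length in E, H'.
    exists a', gam', z'; split; [|exact H'].
    intros i Hi; pose proof (prefix_inj _ _ _ E i Hi) as Ei; simpl in Ei.
    injection Ei; auto. }
  clear H; split; [split|].
  - destruct (H' 1%nat) as [a' [gam' [z' [E [H _]]]]].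
    destruct (E 0%nat) as [_ [<- _]]; [lia|]; apply H; lia.
  - intros n m Hmn; destruct (H' (S n)) as [a' [gam' [z' [E [_ [H _]]]]]].
    destruct (E n) as [_ [<- _]]; [lia|]; destruct (E m) as [<- [<- _]]; [lia|].
    apply H; lia.
  - apply R_ideal; exists z; intros y [n Hy]; apply NNPP; intro Hn.
    destruct (R_closed y z Hn) as [k Hk].
    (* Long enough to fix the [k] entries that exclude [y] and to include round [n], in which [y]
       was covered. *)
    destruct (H' (max k (S n))) as [a' [gam' [z' [E [_ [_ H]]]]]].
    apply (Hk z').
    + intros i Hi; apply E; lia.
    + apply (H n); [lia|]; destruct (E n) as [-> [-> _]]; [lia|exact Hy].
Qed.

Lemma legal_aux_ok a gam z n :
  legal_play D a gam -> (forall y, play_union D a gam y -> R z y) ->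
  aux_ok (prefix (fun i => (a i, (gam i, z i))) n).
Proof.
  intros [H0 H] Hz; exists a, gam, z; rewrite prefix_length.
  split; [reflexivity|split; [auto|split]].
  - intros k m [Hm _]; apply H, Hm.
  - intros k _ y Hy; apply Hz; exists k; exact Hy.
Qed.

(** The auxiliary history for the segment [t] treated in the current round: its entries, paired with
    the actual answers given in the rounds that treated its proper initial segments. *)
Definition simulated (h : list (Gam D)) : list (Gam D * nat) :=
  let t := seq_of_index (length h) in
  prefix (fun i => (nth (seq_index (firstn i t)) h (gone D), nth i t 0%nat)) (length t).

Lemma simulated_prefix gam z i :
  simulated (prefix gam (seq_index (prefix z i))) =
  prefix (fun j => (gam (seq_index (prefix z j)), z j)) i.
Proof.
  unfold simulated; rewrite prefix_length, seq_indexK, prefix_length.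
  apply prefix_ext; intros j Hj.
  rewrite prefix_firstn by lia.
  rewrite !prefix_nth; auto using seq_index_prefix_lt.
Qed.

Lemma closed_fibres_determined : DC_game_determined D.
Proof.
  assert (Hvalid : exists a, ideal D a).
  { exists (fun _ => False); apply R_ideal; exists (fun _ => 0%nat); easy. }
  destruct (classic (I_winning (ideal D) aux_ok [])) as [H|H].
  - left; destruct (I_winning_strategy _ _ _ Hvalid H) as [sigma [Hs Hwin]].
    exists (fun h => sigma (simulated h)); split; [auto|].
    intros gam [H0 Hleg] HU; apply R_ideal in HU; destruct HU as [z Hz].
    (* If the union were in the ideal, some [z] would cover it. The rounds treating the initial
       segments of this [z] form a play against [sigma] that never leaves [aux_ok]. *)
    destruct (Hwin (fun j => (gam (seq_index (prefix z j)), z j))) as [n Hn].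
    apply Hn; clear Hn; simpl.
    apply (legal_aux_ok (fun i => sigma (prefix (fun j => (gam (seq_index (prefix z j)), z j)) i))
      (fun i => gam (seq_index (prefix z i))) z).
    (* The empty segment has index 0, so the first auxiliary answer is the actual [gam 0]. *)
    + split; [exact H0|]; intros k m Hm y Hy.
      apply (Hleg _ (seq_index (prefix z m))); [apply seq_index_prefix_lt, Hm|].
      rewrite simulated_prefix; exact Hy.
    + intros y [k Hy]; apply Hz; exists (seq_index (prefix z k)).
      rewrite simulated_prefix; exact Hy.
  - right; destruct (not_I_winning_strategy _ _ (inhabits (gone D, 0%nat)) H) as [tau Htau].
    (* Player II keeps the entries of [z] to himself. *)
    exists (fun l => fst (tau l)); intros a Ha.
    apply (aux_ok_wins a (fun n => fst (tau (prefix a (S n)))) (fun n => snd (tau (prefix a (S n))))).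
    intro n; erewrite prefix_ext; [apply (Htau a Ha n)|].
    intros i _; simpl; rewrite <- surjective_pairing; reflexivity.
Qed.

End ClosedFibres.

(** * Borel sets as projections of closed sets *)

(** A sequence is split by the pairing function into countably many columns, so that one sequence
    can carry a point and countably many witnesses. *)
Definition col (k : nat) (z : nat -> nat) : nat -> nat := fun i => z (to_nat (k, i)).

Definition cols (w : nat -> nat -> nat) : nat -> nat :=
  fun n => let (k, i) := of_nat n in w k i.

Lemma col_cols k w : col k (cols w) = w k.
Proof. extensionality i; unfold col, cols; rewrite cancel_of_to; reflexivity. Qed.

Lemma closed_forall {I : Type} (C : I -> (nat -> nat) -> Prop) :
  (forall i, baire_closed (C i)) -> baire_closed (fun z => forall i, C i z).
Proof.
  intros H z Hz; apply not_all_ex_not in Hz; destruct Hz as [i Hi].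
  destruct (H i z Hi) as [n Hn]; exists n; intros t Ht Hc; apply (Hn t Ht), Hc.
Qed.

Lemma closed_and C C' :
  baire_closed C -> baire_closed C' -> baire_closed (fun z => C z /\ C' z).
Proof.
  intros H H' z Hz; apply not_and_or in Hz; destruct Hz as [Hz|Hz].
  - destruct (H z Hz) as [n Hn]; exists n; intros t Ht Hc; apply (Hn t Ht), Hc.
  - destruct (H' z Hz) as [n Hn]; exists n; intros t Ht Hc; apply (Hn t Ht), Hc.
Qed.

Lemma closed_locally_constant n (C : (nat -> nat) -> Prop) :
  (forall s t, (forall i, (i < n)%nat -> t i = s i) -> C t -> C s) -> baire_closed C.
Proof. intros H z Hz; exists n; intros t Ht Hc; apply Hz, (H z t Ht Hc). Qed.

Lemma closed_col k C : baire_closed C -> baire_closed (fun z => C (col k z)).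
Proof.
  intros H z Hz; destruct (H _ Hz) as [n Hn].
  (* Entry [i] of column [k] sits at position [to_nat (k, i)]; the bound exceeds these positions for
     all [i] below [n]. *)
  exists (list_max (map (fun i => S (to_nat (k, i))) (seq 0 n))).
  intros t Ht; apply Hn; intros i Hi; apply Ht.
  pose proof (proj1 (list_max_le (map (fun i => S (to_nat (k, i))) (seq 0 n)) _) (le_n _)) as L.
  rewrite Forall_map, Forall_forall in L.
  apply L, in_seq; lia.
Qed.

Lemma closed_select i (C : nat -> (nat -> nat) -> Prop) :
  (forall n, baire_closed (C n)) -> baire_closed (fun z => C (z i) z).
Proof.
  intros H z Hz; destruct (H (z i) z Hz) as [n Hn].
  exists (max n (S i)); intros t Ht; rewrite (Ht i) by lia.
  apply Hn; intros j Hj; apply Ht; lia.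
Qed.

Lemma closed_same_first_col k :
  baire_closed (fun z => forall i, col 0 (col k z) i = col 0 z i).
Proof.
  apply closed_forall; intro i; unfold col.
  apply (closed_locally_constant (S (max (to_nat (k, to_nat (0, i))%nat) (to_nat (0, i)%nat)))).
  intros s t H; rewrite !H by lia; auto.
Qed.

(** Analytic sets as projections of closed sets: the point is column 0, and the other columns are
    free for witnesses. *)
Definition suslin (B : (nat -> nat) -> Prop) : Prop :=
  exists C, baire_closed C /\
    forall s, B s <-> exists z, C z /\ forall i, col 0 z i = s i.

Lemma suslin_ext B B' : (forall s, B s <-> B' s) -> suslin B -> suslin B'.
Proof.
  intros H [C [HC E]]; exists C; split; [exact HC|].
  intro s; rewrite <- H; apply E.
Qed.

Lemma suslin_closed B : baire_closed B -> suslin B.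
Proof.
  intro H; exists (fun z => B (col 0 z)); split; [apply closed_col, H|].
  intro s; split.
  - intro Hs; exists (cols (fun _ => s)); rewrite col_cols; auto.
  - intros [z [Hz E]]; apply functional_extensionality in E; rewrite <- E; exact Hz.
Qed.

Lemma suslin_union (B : nat -> (nat -> nat) -> Prop) :
  (forall n, suslin (B n)) -> suslin (fun s => exists n, B n s).
Proof.
  intro H; destruct (functional_choice _ H) as [C HC].
  (* The first entry of column 1 names the index [n], and column 2 is a witness for [B n] about the
     same point. *)
  exists (fun z => C (z (to_nat (1, 0)%nat)) (col 2 z) /\
            forall i, col 0 (col 2 z) i = col 0 z i); split.
  - apply closed_and; [|apply closed_same_first_col].
    apply (closed_select _ (fun n z => C n (col 2 z))).
    intro n; apply closed_col, HC.
  - intro s; split.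
    + intros [n Hn]; apply HC in Hn; destruct Hn as [w [Hw E]].
      exists (cols (fun k => match k with 0 => s | 1 => fun _ => n | _ => w end)).
      rewrite !col_cols.
      change (cols ?u (to_nat (1, 0)%nat)) with (col 1 (cols u) 0).
      rewrite col_cols; auto.
    + intros [z [[Hz E] E']]; eexists; apply HC.
      exists (col 2 z); split; [exact Hz|]; intro i; rewrite E; apply E'.
Qed.

Lemma suslin_inter (B : nat -> (nat -> nat) -> Prop) :
  (forall n, suslin (B n)) -> suslin (fun s => forall n, B n s).
Proof.
  intro H; destruct (functional_choice _ H) as [C HC].
  exists (fun z => forall n, C n (col (S n) z) /\
            forall i, col 0 (col (S n) z) i = col 0 z i); split.
  - apply closed_forall; intro n.
    apply closed_and; [apply closed_col, HC|apply closed_same_first_col].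
  - intro s; split.
    + intro Hs.
      destruct (functional_choice _ (fun n => proj1 (proj2 (HC n) s) (Hs n))) as [w Hw].
      exists (cols (fun k => match k with 0 => s | S n => w n end)); split.
      * intro n; rewrite !col_cols; apply Hw.
      * intro i; rewrite col_cols; reflexivity.
    + intros [z [Hz E]] n; apply HC; exists (col (S n) z); split; [apply Hz|].
      intro i; rewrite (proj2 (Hz n)); apply E.
Qed.

Lemma suslin_open U : baire_open U -> suslin U.
Proof.
  intro H.
  (* An open set is the union over [n] of the sets of points whose first [n] entries already force
     membership; each of these is clopen. *)
  apply (suslin_ext (fun s => exists n, forall t, (forall i, (i < n)%nat -> t i = s i) -> U t)).
  - intro s; split; [|apply H].
    intros [n Hn]; apply Hn; auto.
  - apply suslin_union; intro n; apply suslin_closed, (closed_locally_constant n).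
    intros s t Hst Ht u Hu; apply Ht; intros i Hi; rewrite Hst, Hu; auto.
Qed.

(** Both halves go through one induction: complementation only swaps them, and the complement of a
    union is an intersection. *)
Lemma borel_suslin B : sgen baire_open B -> suslin B /\ suslin (fun s => ~ B s).
Proof.
  induction 1 as [B H|B B' _ [IH IH'] E|B _ [IH IH']|B _ IH].
  - split; [apply suslin_open, H|].
    apply suslin_closed; intros s Hs; apply NNPP in Hs.
    destruct (H s Hs) as [n Hn]; exists n; auto.
  - split; [apply (suslin_ext B)|apply (suslin_ext (fun s => ~ B s))]; auto.
    intro s; rewrite (E s); reflexivity.
  - split; [exact IH'|].
    apply (suslin_ext B); [|exact IH].
    intro s; split; [tauto|apply NNPP].
  - split; [apply suslin_union; intro n; apply IH|].
    apply (suslin_ext (fun s => forall n, ~ B n s)).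
    + intro s; split; [intros H [n Hn]; apply (H n Hn)|apply not_ex_all_not].
    + apply suslin_inter; intro n; apply IH.
Qed.

(* The column [col 1 z] records which of the sets [B k] contain the point. *)
Lemma borel_sequence_code (B : nat -> (nat -> nat) -> Prop) :
  (forall k, sgen baire_open (B k)) ->
  exists C, baire_closed C /\
    (forall s, exists z, C z /\ forall k, col 1 z k <> 0%nat <-> B k s) /\
    (forall z, C z -> exists s, forall k, col 1 z k <> 0%nat <-> B k s).
Proof.
  intro H.
  destruct (functional_choice _ (fun k => proj1 (borel_suslin _ (H k)))) as [C1 H1].
  destruct (functional_choice _ (fun k => proj2 (borel_suslin _ (H k)))) as [C0 H0].
  (* Column [2 + k] certifies the recorded bit for [B k]: a witness for the complement if the bit is
     0, for [B k] otherwise. *)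
  set (K := fun k m => match m with 0 => C0 k | S _ => C1 k end : (nat -> nat) -> Prop).
  exists (fun z => forall k, K k (z (to_nat (1, k)%nat)) (col (2 + k) z) /\
            forall i, col 0 (col (2 + k) z) i = col 0 z i).
  split; [|split].
  - apply closed_forall; intro k; apply closed_and; [|apply closed_same_first_col].
    apply (closed_select _ (fun m z => K k m (col (2 + k) z))).
    intros [|m]; apply closed_col; [apply H0|apply H1].
  - intro s.
    assert (E : forall k, exists mw : nat * (nat -> nat),
      (fst mw <> 0%nat <-> B k s) /\ K k (fst mw) (snd mw) /\ forall i, col 0 (snd mw) i = s i).
    { intro k; destruct (classic (B k s)) as [Hk|Hk].
      - destruct (proj1 (proj2 (H1 k) s) Hk) as [w Hw]; exists (1%nat, w); simpl; easy.
      - destruct (proj1 (proj2 (H0 k) s) Hk) as [w Hw]; exists (0%nat, w); simpl; easy. }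
    destruct (functional_choice _ E) as [mw Hmw].
    exists (cols (fun k => match k with
              | 0 => s | 1 => fun k => fst (mw k) | S (S k) => snd (mw k) end)).
    split; intro k.
    + change (cols ?u (to_nat (1, k)%nat)) with (col 1 (cols u) k).
      rewrite !col_cols; apply Hmw.
    + rewrite col_cols; apply Hmw.
  - intros z Hz; exists (col 0 z); intro k; destruct (Hz k) as [HK E].
    unfold col at 1; destruct (z (to_nat (1, k)%nat)) as [|m]; simpl in HK.
    + assert (Hk : ~ B k (col 0 z)) by (apply H0; exists (col (2 + k) z); auto).
      split; [congruence|contradiction].
    + split; [intros _|congruence].
      apply H1; exists (col (2 + k) z); auto.
Qed.

(** * Analytic families of closed sets *)

Section Polish.
Context {X : Type} (d : X -> X -> R) (e : nat -> option X).
Context (d_metric : is_metric d).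
Context (e_dense : forall x eps, 0 < eps -> exists n y, e n = Some y /\ d x y < eps).

(** [k] codes a centre in the dense sequence and a radius; the ball is empty when [e] lists no point
    there. *)
Definition basic_ball (k : nat) (x : X) : Prop :=
  let (n, m) := of_nat k in
  match e n with Some c => d c x < / INR (S m) | None => False end.

Lemma basic_ball_open k : m_open d (basic_ball k).
Proof.
  unfold basic_ball; destruct (of_nat k) as [n m]; destruct (e n) as [c|]; intros x Hx; [|easy].
  exists (/ INR (S m) - d c x); split; [lra|].
  intros y Hy; destruct d_metric as [_ [_ [_ Htri]]]; specialize (Htri c x y); lra.
Qed.

Lemma basic_ball_separates (F : X -> Prop) x :
  m_closed d F -> ~ F x -> exists k, basic_ball k x /\ forall y, basic_ball k y -> ~ F y.
Proof.
  intros HF Hx; destruct (HF x Hx) as [eps [Heps H]].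
  destruct (archimed_cor1 (eps / 2)) as [[|m] [Hm Hpos]]; [lra|lia|].
  destruct (e_dense x (/ INR (S m))) as [n [c [Hc Hd]]].
  { apply Rinv_0_lt_compat, lt_0_INR; lia. }
  destruct d_metric as [_ [_ [Hsym Htri]]].
  exists (to_nat (n, m)); unfold basic_ball; rewrite cancel_of_to, Hc.
  split; [rewrite Hsym; exact Hd|].
  intros y Hy; apply H; specialize (Htri x c y); lra.
Qed.

(** A closed set is determined by the basic balls meeting it, and meeting a given ball is a Borel
    condition on [s]. So [z] codes [f s] by recording these balls, and membership of a fixed point
    becomes a closed condition on [z]. *)
Lemma analytic_closed_fibres (f : (nat -> nat) -> ClosedSet d) :
  borel_to_effros d f ->
  exists R : (nat -> nat) -> X -> Prop,
    (forall x, baire_closed (fun z => R z x)) /\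
    forall b : X -> Prop,
      (exists s, forall x, b x -> proj1_sig (f s) x) <-> (exists z, forall x, b x -> R z x).
Proof.
  intro Hf.
  destruct (borel_sequence_code (fun k s => exists x, proj1_sig (f s) x /\ basic_ball k x))
    as [C [HC [Hcode Hdecode]]].
  { intro k; apply (Hf (fun F => exists x, proj1_sig F x /\ basic_ball k x)).
    apply sg_base; exists (basic_ball k); split; [apply basic_ball_open|reflexivity]. }
  exists (fun z x => C z /\ forall k, basic_ball k x -> col 1 z k <> 0%nat); split.
  - intro x; apply closed_and; [exact HC|].
    (* The second use of [closed_forall] ranges over proofs that the ball contains [x]. *)
    apply closed_forall; intro k; apply closed_forall; intros _.
    apply (closed_locally_constant (S (to_nat (1, k)%nat))).
    intros s t E; unfold col; rewrite E by lia; auto.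
  - intro b; split.
    + intros [s Hs]; destruct (Hcode s) as [z [Hz E]]; exists z; intros x Hx.
      split; [exact Hz|]; intros k Hk; apply E; exists x; auto.
    + intros [z Hz].
      (* For empty [b] nothing shows that [z] is a code, and any [s] will do. *)
      destruct (classic (exists x, b x)) as [[x0 Hx0]|Hemp].
      * destruct (Hdecode z (proj1 (Hz x0 Hx0))) as [s E]; exists s; intros x Hx.
        apply NNPP; intro Hn.
        destruct (basic_ball_separates _ x (proj2_sig (f s)) Hn) as [k [Hk Hdis]].
        destruct (proj1 (E k) (proj2 (Hz x Hx) k Hk)) as [y [Hy Hky]].
        apply (Hdis y Hky Hy).
      * exists (fun _ => 0%nat); intros x Hx; exfalso; apply Hemp; exists x; exact Hx.
Qed.

End Polish.

Theorem mainTheorem7 (X : Type) (D : DynIdeal X) :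
  (~ DC_in_W D -> PlayerI_wins D) /\
  (forall d : X -> X -> R, polish_metric d ->
     forall A : ClosedSet d -> Prop,
       effros_analytic d A -> ideal_generated_by D d A ->
       DC_game_determined D).
Proof.
  split; [apply not_DC_PlayerI_wins|].
  intros d [Hd [_ [e He]]] A HA Hgen; destruct HA as [Hemp|[f [Hf HAf]]].
  (* An empty family generates no set at all, so Player I has no move. *)
  - right; exists (fun _ => gone D); intros a Ha; exfalso.
    destruct (proj1 (Hgen _) (Ha 0%nat)) as [F [HF _]]; apply (Hemp F HF).
  - destruct (analytic_closed_fibres d e Hd He f Hf) as [R [Rc HR]].
    apply (closed_fibres_determined D R Rc); intro b.
    rewrite <- (HR b), (Hgen b); split.
    + intros [F [HF Hb]]; apply HAf in HF; destruct HF as [s <-]; exists s; exact Hb.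
    + intros [s Hb]; exists (f s); split; [apply HAf; exists s; reflexivity|exact Hb].
Qed.
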